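(* Let $S$ be a left equalizer simple semigroup without idempotents, and let $P:S/\theta\to S$ be a mapping such that $P([s]_\theta)\in[s]_\theta$ for every $s\in S$. Then there exist a semigroup $S''$ and a mapping $P'':S/\theta\to S''$ such that the semigroup $(S'', S/\theta; \circ_{P''})$ is simple and contains a minimal left ideal, and the semigroup $(S, S/\theta; \circ_P)$ can be embedded into $(S'', S/\theta; \circ_{P''})$.
   Context: A semigroup $S$ is left equalizer simple if, for arbitrary $a,b\in S$, the assumption $x_0a=x_0b$ for some $x_0\in S$ implies $xa=xb$ for all $x\in S$. The congruence $\theta$ on $S$ is defined by $(a,b)\in\theta$ if and only if $xa=xb$ for all $x\in S$; $[s]_\theta$ is the $\theta$-class of $s\in S$, and $S/\theta$ is the factor semigroup. A semigroup is simple if it has no proper two-sided ideals (i.e. its only non-empty two-sided ideal is itself). For a semigroup $T$, a non-empty set $\Lambda$ and a mapping $Q:\Lambda\to T$, $(T,\Lambda;\circ_Q)$ denotes the semigroup with underlying set $T\times\Lambda$ and operation $(s,\lambda)\circ_Q(t,\mu)=(s\,Q(\lambda)\,t,\ \mu)$. An embedding is an injective semigroup homomorphism. *)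

(* Defs.v *)
From HB Require Import structures.
From mathcomp Require Import all_boot boolp classical_sets.

Set Implicit Arguments.
Unset Strict Implicit.
Unset Printing Implicit Defensive.

Local Open Scope group_scope.
Local Open Scope quotient_scope.

Definition left_equalizer_simple (S : semigroupType) : Prop :=
  forall a b : S,
    (exists x0 : S, x0 * a = x0 * b) -> forall x : S, x * a = x * b.

Definition idempotent_free (S : semigroupType) : Prop :=
  forall e : S, e * e <> e.

Definition left_ideal (S : semigroupType) (L : set S) : Prop :=
  nonempty L /\ forall x y : S, L y -> L (x * y).

Definition two_sided_ideal (S : semigroupType) (I : set S) : Prop :=
  nonempty I /\ forall x y : S, I y -> I (x * y) /\ I (y * x).

Definition minimal_left_ideal (S : semigroupType) (L : set S) : Prop :=
  left_ideal L /\ forall L' : set S, left_ideal L' -> subset L' L -> L' = L.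

Definition simple_semigroup (S : semigroupType) : Prop :=
  forall I : set S, two_sided_ideal I -> I = setT.

Section Theta.
Variable S : semigroupType.

Definition theta (a b : S) : Prop := forall x : S, x * a = x * b.

Definition theta_class (s : S) : set S := [set t | theta s t]%classic.

Definition thetab (a b : S) : bool := `[< theta a b >].

Lemma thetab_equiv : equiv_class_of thetab.
Proof.
split=> [a|a b|b a c].
- exact/asboolP.
- by apply/asboolP/asboolP => h x; rewrite h.
- by move=> /asboolP hab /asboolP hbc; apply/asboolP => x; rewrite hab hbc.
Qed.

Canonical thetab_equiv_rel : equiv_rel S := EquivRelPack thetab_equiv.

(* The factor semigroup S/theta; [s]_theta, seen as one of its elements, is
   \pi_(theta_quot S) s. *)
Definition theta_quot : Type := {eq_quot thetab_equiv_rel}.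

HB.instance Definition _ : EqQuotient S thetab_equiv_rel theta_quot :=
  EqQuotient.on theta_quot.
HB.instance Definition _ := Choice.on theta_quot.

Lemma theta_quotP (a b : S) :
  \pi_theta_quot a = \pi_theta_quot b <-> theta a b.
Proof.
split=> [/eqmodP/asboolP // | h].
by apply/eqmodP/asboolP.
Qed.

Definition theta_quot_mul (u v : theta_quot) : theta_quot :=
  \pi_theta_quot (repr u * repr v).

Lemma theta_quot_mulE (a b : S) :
  theta_quot_mul (\pi_theta_quot a) (\pi_theta_quot b) = \pi_theta_quot (a * b).
Proof.
have ha : theta (repr (\pi_theta_quot a)) a by apply/theta_quotP; rewrite reprK.
have hb : theta (repr (\pi_theta_quot b)) b by apply/theta_quotP; rewrite reprK.
by apply/theta_quotP => x; rewrite mulgA hb ha mulgA.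
Qed.

Lemma theta_quot_mulA : associative theta_quot_mul.
Proof.
move=> u v w; elim/quotW: u => a; elim/quotW: v => b; elim/quotW: w => c.
rewrite (theta_quot_mulE b c) (theta_quot_mulE a b).
by rewrite (theta_quot_mulE a (b * c)) (theta_quot_mulE (a * b) c) mulgA.
Qed.

HB.instance Definition _ := isSemigroup.Build theta_quot theta_quot_mulA.

End Theta.

(* The set T x L with (s, l) o_Q (t, m) = (s Q(l) t, m); the unused argument Q
   keys the semigroup structure. *)
Definition sandwich (T : semigroupType) (L : choiceType) (Q : L -> T) : Type :=
  (T * L)%type.

Section Sandwich.
Variables (T : semigroupType) (L : choiceType) (Q : L -> T).

HB.instance Definition _ := Choice.copy (sandwich Q) (T * L)%type.

Definition sandwich_mul (u v : sandwich Q) : sandwich Q :=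
  (u.1 * Q u.2 * v.1, v.2).

Lemma sandwich_mulA : associative sandwich_mul.
Proof. by move=> u v w; rewrite /sandwich_mul /= !mulgA. Qed.

HB.instance Definition _ := isSemigroup.Build (sandwich Q) sandwich_mulA.

End Sandwich.

(* Main.v *)
Require Import Defs.
From HB Require Import structures.
From mathcomp Require Import all_boot boolp classical_sets.

(** The theorem reduces to an embedding of [S] into a left simple semigroup [T].

    If [T] is left simple, then in any sandwich semigroup over [T] the slices
    [T x {l}] are minimal left ideals, and a two-sided ideal contains one slice,
    hence every slice ([left_simple_sandwich_simple],
    [sandwich_slice_minimal]).  An embedding [phi : S -> T] induces the embedding
    [(s, l) |-> (phi s, l)] of sandwich semigroups as soon as the sandwich
    function on the target is [phi \o P].

    The embedding into a left simple semigroup ([left_simple_embedding], a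
    theorem of Cohn) uses a semigroup of the kind introduced by Teissier.  Given
    a surjection [pi : A -> X], its elements are the maps [f : X -> A] such that
    [pi \o f] is injective and misses a subset of [X] equipotent to [X]; the
    product of [f] and [g] is [f \o pi \o g].  To solve [h * g = f] for [h], the
    value of [h] is forced on the image of [pi \o g]; the complement of that
    image is sent into half of a copy of [X] that [pi \o f] misses, and the
    other half of this copy is then missed by [pi \o h].

    For [S], let [X] be [S/theta] with an identity adjoined, and [A] be [S] with
    an identity adjoined, both multiplied by the set of lists over [S/theta] with
    an identity, so that the lists encode [X] itself and make room in the
    complements.  An element [s] acts as the map [X -> A] induced by left
    translation; this is well defined because [theta] identifies exactly the
    elements that left translations cannot separate.  No information is lost,
    as the identity of [X] is sent to [s] itself in [A].  The composite with
    [pi] is left translation by the class of [s] on [S/theta] with an identity: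
    it is injective because [S/theta] is left cancellative and because
    [s * x] is never [theta]-equivalent to [s], which would produce an
    idempotent ([theta_mulr_free]). *)

Set Implicit Arguments.
Unset Strict Implicit.
Unset Printing Implicit Defensive.

(** * Sandwich semigroups over a left simple semigroup *)

Section LeftSimple.
Local Open Scope group_scope.

Definition left_simple (T : semigroupType) : Prop :=
  forall a b : T, exists x, x * a = b.

Variables (T : semigroupType) (L : choiceType) (Q : L -> T).
Hypothesis lsT : left_simple T.

Lemma left_simple_sandwich_solve (u : sandwich Q) (t : T) :
  exists v : sandwich Q, v * u = (t, u.2).
Proof. by have [x <-] := lsT (Q u.2 * u.1) t; exists (x, u.2); rewrite mulgA. Qed.

(** Left multiples of an element of the ideal fill its slice; multiplying on the
    right by an element of another slice moves this slice onto the other. *)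
Lemma left_simple_sandwich_simple : simple_semigroup (sandwich Q).
Proof.
move=> I [[u Iu] Iid]; apply/seteqP; split=> // -[t m] _.
have [x xE] := lsT (Q u.2 * t) t.
have [v vE] := left_simple_sandwich_solve u x.
have Ix : I (x, u.2) by rewrite -vE; have [] := Iid v u Iu.
suff -> : (t, m) = ((x, u.2) : sandwich Q) * (t, m).
  by have [] := Iid (t, m) _ Ix.
by rewrite -[in LHS]xE mulgA.
Qed.

Lemma sandwich_slice_minimal (t0 : T) (l : L) :
  minimal_left_ideal [set u : sandwich Q | u.2 = l].
Proof.
split=> [|I [[u Iu] Iid] subI].
  by split=> //; exists (t0, l).
apply/seteqP; split=> // -[t m] /= ->.
have [v vE] := left_simple_sandwich_solve u t.
have <- : u.2 = l by apply: subI.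
by rewrite -vE; apply: Iid.
Qed.

End LeftSimple.

Section SandwichMap.
Local Open Scope group_scope.
Variables (S T : semigroupType) (L : choiceType) (P : L -> S).
Variable phi : {multiplicative S -> T}.

Definition sandwich_map (u : sandwich P) : sandwich (phi \o P) :=
  (phi u.1, u.2).

Lemma sandwich_mapM : {morph sandwich_map : u v / u * v}.
Proof. by move=> u v; rewrite /sandwich_map /= !gmulfM. Qed.

HB.instance Definition _ :=
  isMultiplicative.Build (sandwich P) (sandwich (phi \o P)) sandwich_map
    sandwich_mapM.

Lemma sandwich_map_inj : injective phi -> injective sandwich_map.
Proof. by move=> phi_inj [s l] [t m] [/phi_inj -> ->]. Qed.

End SandwichMap.

(** * Teissier semigroups *)

(** The size of the complement of the image is expressed by an injection of the
    whole type into it, which avoids cardinal arithmetic. *)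
Definition coequipotent_injection (X : Type) (g : X -> X) : Prop :=
  injective g /\
  exists j : X -> X, injective j /\ forall x y : X, j x <> g y.

Lemma coequipotent_injection_comp (X : Type) (g h : X -> X) :
  coequipotent_injection g -> coequipotent_injection h ->
  coequipotent_injection (g \o h).
Proof.
move=> [g_inj [j [j_inj jg]]] [h_inj _]; split; first exact: inj_comp.
by exists j; split=> // x y; apply: jg.
Qed.

Record teissier (A X : Type) (pi : A -> X) := Teissier {
  teissier_fun :> X -> A;
  teissierP : coequipotent_injection (pi \o teissier_fun) }.

Section Teissier.
Variables (A X : Type) (pi : A -> X).

HB.instance Definition _ := gen_eqMixin (teissier pi).
HB.instance Definition _ := gen_choiceMixin (teissier pi).

Lemma teissier_ext (f g : teissier pi) : f =1 g -> f = g.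
Proof.
case: f g => [f fP] [g gP] /= /funext fg; case: _ / fg in gP *.
by rewrite (Prop_irrelevance fP gP).
Qed.

Definition teissier_mul (f g : teissier pi) : teissier pi :=
  @Teissier _ _ pi (f \o pi \o g)
    (coequipotent_injection_comp (teissierP f) (teissierP g)).

Lemma teissier_mulA : associative teissier_mul.
Proof. by move=> f g h; apply: teissier_ext. Qed.

HB.instance Definition _ := isSemigroup.Build (teissier pi) teissier_mulA.

(** The maps [c1] and [c2] give two disjoint copies of [X] inside [X]: one receives the
    part where the solution of [h * g = f] is not forced, and the other keeps
    the complement of the image of [pi \o h] large. *)
Lemma teissier_left_simple (sigma : X -> A) (c1 c2 : X -> X) :
  cancel sigma pi -> injective c1 -> injective c2 ->
  (forall x y, c1 x <> c2 y) -> left_simple (teissier pi).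
Proof.
move=> sigmaK c1_inj c2_inj c12 g f.
have [g_inj _] := teissierP g; have [f_inj [j [j_inj jf]]] := teissierP f.
pose hits x y := pi (g y) = x.
have /choice[h hP] : forall x, exists a,
    (exists2 y, hits x y & a = f y) \/
    ((forall y, ~ hits x y) /\ a = sigma (j (c1 x))).
  move=> x; have [[y xy]|nx] := pselect (exists y, hits x y).
    by exists (f y); left; exists y.
  by exists (sigma (j (c1 x))); right; split=> // y xy; apply: nx; exists y.
have h_coeq : coequipotent_injection (pi \o h).
  split=> [x x'|] /=.
    case: (hP x) => [[y <- ->]|[_ ->]]; case: (hP x') => [[y' <- ->]|[_ ->]].
    - by move=> /f_inj ->.
    - by rewrite sigmaK => /esym/jf.
    - by rewrite sigmaK => /jf.
    - by rewrite !sigmaK => /j_inj/c1_inj.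
  exists (j \o c2); split=> [|x x' /=]; first exact: inj_comp.
  case: (hP x') => [[y _ ->]|[_ ->]]; first exact: jf.
  by rewrite sigmaK => /j_inj/esym/c12.
exists (Teissier h_coeq); apply: teissier_ext => x /=.
case: (hP (pi (g x))) => [[y /g_inj -> //]|[nx _]].
by case: (nx x).
Qed.

End Teissier.

(** * Embedding into a left simple semigroup *)

Section Embedding.
Local Open Scope group_scope.
Local Open Scope quotient_scope.
Variable S : semigroupType.
Hypothesis lesS : left_equalizer_simple S.
Hypothesis idfS : idempotent_free S.

Lemma theta_cancel (s a b : S) : theta (s * a) (s * b) -> theta a b.
Proof. by move=> /(_ s) e; apply: lesS; exists (s * s); rewrite -!mulgA. Qed.

(** If [s * x] is equivalent to [s], then cancelling [s] makes [x] and [x * x]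
    equivalent; hence [x * x], [x * x * x] and all higher powers coincide, and
    [x * x] is idempotent. *)
Lemma theta_mulr_free (s x : S) : ~ theta s (s * x).
Proof.
move=> sx; have /theta_cancel xx : theta (s * x) (s * (x * x)).
  move=> y; have -> : y * (s * (x * x)) = y * (s * x) * x by rewrite !mulgA.
  by rewrite -!sx -mulgA -sx.
by apply: (idfS (e := x * x)); rewrite -mulgA -!xx.
Qed.

Let label := option (theta_quot S).
Let X : Type := (option (theta_quot S) * seq label)%type.
Let A : Type := (option S * seq label)%type.

Definition class_proj (a : A) : X :=
  (omap (\pi_(theta_quot S)) a.1, a.2).

Definition class_repr (x : X) : A := (omap repr x.1, x.2).

Lemma class_reprK : cancel class_repr class_proj.
Proof. by move=> [[u|] l]; rewrite /class_proj /class_repr //= reprK. Qed.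

Definition translation (s : S) (x : X) : A :=
  (Some (if x.1 is Some u then s * repr u else s), x.2).

(** The value does not depend on the representative: this is what [theta] is
    made for. *)
Lemma translation_pi (s t : S) (l : seq label) :
  translation s (Some (\pi_(theta_quot S) t), l) = (Some (s * t), l).
Proof.
have /theta_quotP rt : \pi_(theta_quot S) (repr (\pi_(theta_quot S) t))
  = \pi_(theta_quot S) t by rewrite reprK.
by rewrite /translation /= rt.
Qed.

Lemma translation_coequipotent (s : S) :
  coequipotent_injection (class_proj \o translation s).
Proof.
split.
  move=> [u l] [v m] /= [+ ->].
  case: u => [u|]; case: v => [v|] //= /theta_quotP.
  - by move=> /theta_cancel/theta_quotP; rewrite !reprK => ->.
  - by move=> us; case: (@theta_mulr_free s (repr u)) => x; rewrite us.
  - by move=> /theta_mulr_free.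
(* No value has the identity as its first component, and the lists of labels are
   numerous enough to encode all of [X] next to it. *)
by exists (fun x => (None, x.1 :: x.2)); split=> // -[u l] [v m] [-> ->].
Qed.

Definition translation_map (s : S) : teissier class_proj :=
  Teissier (translation_coequipotent s).

Lemma translation_mapM : {morph translation_map : s t / s * t}.
Proof.
move=> s t; apply: teissier_ext => -[u l] /=.
by rewrite /class_proj /= translation_pi; rewrite /translation /=; case: u => [u|] //=; rewrite -mulgA.
Qed.

HB.instance Definition _ :=
  isMultiplicative.Build S (teissier class_proj) translation_map
    translation_mapM.

Lemma translation_map_inj : injective translation_map.
Proof.
by move=> s t st; have [] := congr1 (fun f => teissier_fun f (None, [::])) st.
Qed.

Lemma translation_codomain_left_simple (s0 : S) :
  left_simple (teissier class_proj).
Proof.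
(* The two halves are told apart by their first component. *)
pose c (b : option (theta_quot S)) (x : X) : X := (b, x.1 :: x.2).
have c_inj b : injective (c b) by move=> [u l] [v m] [-> ->].
apply: (teissier_left_simple class_reprK (c_inj None)
  (c_inj (Some (\pi_(theta_quot S) s0)))) => x y.
by case.
Qed.

Lemma left_simple_embedding (s0 : S) :
  exists T : semigroupType, left_simple T /\
    exists phi : {multiplicative S -> T}, injective phi.
Proof.
exists (teissier class_proj); split.
  exact: translation_codomain_left_simple s0.
by exists translation_map; apply: translation_map_inj.
Qed.

End Embedding.

Theorem theorem2 (S : semigroupType) (P : theta_quot S -> S) :
  inhabited S ->
  left_equalizer_simple S ->
  idempotent_free S ->
  (forall s : S, theta_class s (P (\pi_(theta_quot S)%qT s))) ->
  exists (S'' : semigroupType) (P'' : theta_quot S -> S''),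
    simple_semigroup (sandwich P'')
    /\ (exists L : set (sandwich P''), minimal_left_ideal L)
    /\ (exists f : {multiplicative sandwich P -> sandwich P''}, injective f).
Proof.
move=> [s0] lesS idfS _.
have [T [lsT [phi phi_inj]]] := left_simple_embedding lesS idfS s0.
exists T, (phi \o P); split; first exact: left_simple_sandwich_simple.
split.
  exists [set u : sandwich (phi \o P) | u.2 = \pi_(theta_quot S)%qT s0]%classic.
  exact: sandwich_slice_minimal (phi s0) _.
by exists (sandwich_map phi); apply: sandwich_map_inj.
Qed.
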